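(* Let $V_0=\mathbb{C}[x_1,x_2,\dots]$ with each $x_i$ primitive, let $A$ be a commutative $\mathbb{C}$-algebra, let $r$ be an $A$-valued bicharacter on $V_0$, put $q_{mn}=r(x_m\otimes x_n)$ and \[ Q_p=\sum_{m,n\ge1}q_{mn}\frac{\partial^2}{\partial x_m\partial x_n}. \] Let $s=r\circ r^t$ be the symmetrization of $r$ and $\bullet=\bullet_s$. Then for all $P\in V_0$, \[ e^{Q_p}(P)=\mathrm{EQ}_r(P)=\sum r(P'\otimes P'')P''', \] and moreover $e^{Q_p}(P)=P^{\bullet}$. Furthermore $e^{Q_p}$ is a homomorphism from $(V_0\otimes A,\cdot)$ to $(V_0\otimes A,\bullet)$.
   Context: Hopf structure on $V_0$: $\Delta(x_i)=x_i\otimes1+1\otimes x_i$, $\eta(x_i)=0$. Sweedler notation: $\Delta(P)=\sum P'\otimes P''$, $\Delta^2(P)=\sum P'\otimes P''\otimes P'''$. An $A$-valued bicharacter is a linear map $r:V_0\otimes V_0\to A$ with $r(1\otimes a)=\eta(a)=r(a\otimes1)$, $r(ab\otimes c)=\sum r(a\otimes c')r(b\otimes c'')$, $r(a\otimes bc)=\sum r(a'\otimes b)r(a''\otimes c)$. $r^t(a\otimes b)=r(b\otimes a)$, and $(r\circ t)(a\otimes b)=\sum r(a'\otimes b')t(a''\otimes b'')$; the symmetrization $s=r\circ r^t$ is a symmetric bicharacter. The product $\bullet_s$ on $V_0\otimes A$ is the $A$-bilinear extension of $a\bullet_s b=\sum a'b'\,s(a''\otimes b'')$; it is associative and commutative with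 unit $1$. For $P\in V_0$ written as a linear combination of monomials $x_{i_1}x_{i_2}\cdots x_{i_k}$, the $\bullet$ polynomial $P^\bullet$ is the same linear combination of the elements $x_{i_1}\bullet x_{i_2}\bullet\cdots\bullet x_{i_k}$ (with the empty monomial $1$ mapped to $1$). $e^{Q_p}=\sum_k Q_p^k/k!$, acting $A$-linearly. *)

(* Defs.v *)
From HB Require Import structures.
From mathcomp Require Import all_boot all_order all_algebra.
From mathcomp Require Import finmap.
From mathcomp Require Import reals.
From mathcomp Require Import complex.
From mathcomp.multinomials Require Import monalg.

Set Implicit Arguments.
Unset Strict Implicit.
Unset Printing Implicit Defensive.

Import GRing.Theory Num.Theory.
Local Open Scope ring_scope.

Notation mpol K I := {malg K[{cmonom I}]}.

Definition mX {K : ringType} {I : choiceType} (i : I) : mpol K I := << ucm i >>.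
Definition mmon {K : ringType} {I : choiceType} (m : cmonom I) : mpol K I := << m >>.

Definition msubst {K : comRingType} {I J : choiceType}
  (f : I -> mpol K J) (P : mpol K I) : mpol K J :=
  \sum_(m <- msupp P) P@_m *: \prod_(i <- finsupp m) f i ^+ m i.

Definition counit {K : ringType} {I : choiceType} (P : mpol K I) : K := P@_mone.

(* k-fold tensor power V0^{(x)k} is identified with K[x_(i,j) | i : nat, j < k],
   the j-th tensor factor carrying the variables x_(i,j).
   Iterated coproduct Delta^{k-1} : x_i |-> sum_j x_(i,j) (x_i primitive). *)
Definition Deltak {K : comRingType} (k : nat) (P : mpol K nat)
  : mpol K (nat * 'I_k)%type :=
  msubst (fun i => \sum_(j < k) mX (i, j)) P.

Definition slot (k : nat) (m : cmonom (nat * 'I_k)%type) (j : 'I_k) : cmonom nat :=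
  ([cmonom m (i, j) | i in [fset p.1 | p in finsupp m]])%M.

(* Sweedler sum  sum F(P_(1), ..., P_(k))  for a k-multilinear F; the
   scalars of V0 act on M through emb. *)
Definition sweedler {K : comRingType} {S : ringType} {M : lmodType S}
  (emb : K -> S) (k : nat) (F : ('I_k -> mpol K nat) -> M) (P : mpol K nat) : M :=
  \sum_(m <- msupp (Deltak k P)) emb (Deltak k P)@_m *: F (fun j => mmon (slot m j)).

Definition sw2 {K : comRingType} {S : ringType} {M : lmodType S}
  (emb : K -> S) (F : mpol K nat -> mpol K nat -> M) (P : mpol K nat) : M :=
  sweedler emb (k := 2) (fun v => F (v (@Ordinal 2 0 isT)) (v (@Ordinal 2 1 isT))) P.

Definition sw3 {K : comRingType} {S : ringType} {M : lmodType S}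
  (emb : K -> S) (F : mpol K nat -> mpol K nat -> mpol K nat -> M)
  (P : mpol K nat) : M :=
  sweedler emb (k := 3)
    (fun v => F (v (@Ordinal 3 0 isT)) (v (@Ordinal 3 1 isT)) (v (@Ordinal 3 2 isT))) P.

Section Bichar.
Context {R : realType} {A : comAlgType R[i]}.
Local Notation C := R[i].
Local Notation V0 := (mpol C nat).
Local Notation VA := (mpol A nat).

(* A linear map V0 (x) V0 -> A is represented by the C-bilinear map
   (a, b) |-> r(a (x) b). *)
Definition bicharacter (r : V0 -> V0 -> A) : Prop :=
  [/\ (forall (k : C) (a b c : V0), r (k *: a + b) c = k *: r a c + r b c),
      (forall (k : C) (a b c : V0), r a (k *: b + c) = k *: r a b + r a c),
      (forall a : V0, r 1 a = (counit a)%:A /\ r a 1 = (counit a)%:A),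
      (forall a b c : V0, r (a * b) c = sw2 id (fun c1 c2 => r a c1 * r b c2) c) &
      (forall a b c : V0, r a (b * c) = sw2 id (fun a1 a2 => r a1 b * r a2 c) a)].

Definition transp (r : V0 -> V0 -> A) : V0 -> V0 -> A := fun a b => r b a.

Definition convo (r t : V0 -> V0 -> A) : V0 -> V0 -> A :=
  fun a b => sw2 id (fun a1 a2 => sw2 id (fun b1 b2 => r a1 b1 * t a2 b2) b) a.

(* V0 -> V0 (x) A,  P |-> P (x) 1 *)
Definition toA (P : V0) : VA := \sum_(m <- msupp P) << (P@_m)%:A *g m >>.

Definition bullet0 (s : V0 -> V0 -> A) (a b : V0) : VA :=
  sw2 (fun c : C => c%:A)
    (fun a1 a2 => sw2 (fun c : C => c%:A) (fun b1 b2 => s a2 b2 *: toA (a1 * b1)) b) a.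

Definition bullet (s : V0 -> V0 -> A) (P Q : VA) : VA :=
  \sum_(m <- msupp P) \sum_(n <- msupp Q) (P@_m * Q@_n) *: bullet0 s (mmon m) (mmon n).

Definition bmon (s : V0 -> V0 -> A) (m : cmonom nat) : VA :=
  \big[bullet s/1]_(i <- finsupp m) iter (m i) (bullet s (mX i)) 1.

Definition Pbullet (s : V0 -> V0 -> A) (P : V0) : VA :=
  \sum_(m <- msupp P) (P@_m)%:A *: bmon s m.

Definition mderiv (i : nat) (P : VA) : VA :=
  \sum_(m <- msupp P) << P@_m *+ m i *g divcm m (ucm i) >>.

Definition vars (P : VA) : seq nat :=
  undup (flatten [seq (enum_fset (finsupp m)) | m : cmonom nat <- msupp P]).

(* Q_p = sum_{m,n} q_mn d^2/dx_m dx_n, q_mn = r(x_m (x) x_n), acting A-linearly;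
   only the (finitely many) variables occurring in P contribute. *)
Definition Qp (r : V0 -> V0 -> A) (P : VA) : VA :=
  \sum_(m <- vars P) \sum_(n <- vars P) r (mX m) (mX n) *: mderiv m (mderiv n P).

(* e^{Q_p} = sum_k Q_p^k / k!; Q_p lowers degree by 2, so the terms with
   k >= msize P (= total degree + 1) vanish and the sum is finite. *)
Definition expQ (r : V0 -> V0 -> A) (P : VA) : VA :=
  \sum_(k < (msize P).+1) ((k`!)%:R^-1 : C)%:A *: iter k (Qp r) P.

Definition EQ (r : V0 -> V0 -> A) (P : V0) : VA :=
  sw3 (fun c : C => c%:A) (fun a b c => r a b *: toA c) P.

End Bichar.

(* Main.v *)
(* All the structures involved are determined by how they interact with the
   multiplication by a variable [x_i].  The coproduct of [x_i P] is obtained by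
   multiplying each slot in turn by [x_i], and a derivation of one slot of the
   coproduct is the coproduct of the derivation.  The bicharacter axioms then say
   [r (x_i a, b) = r (a, D b)] with [D = sum_j q_ij d/dx_j].  Writing [D_i] for
   [sum_j (q_ij + q_ji) d/dx_j] and [L_i P = x_i P + D_i P], it follows that
   [EQ_r (x_i P) = L_i (EQ_r P)] and [(L_i P) . Q = L_i (P . Q)] for the bullet
   product.  Since [Q_p] commutes with [D_i] and [Q_p (x_i P) = x_i (Q_p P) + D_i P],
   also [e^Q_p (x_i P) = L_i (e^Q_p P)]; induction on monomials concludes. *)
Require Import Defs.
From HB Require Import structures.
From mathcomp Require Import all_boot all_order all_algebra.
From mathcomp Require Import finmap reals complex.
From mathcomp.multinomials Require Import monalg.
Import GRing.Theory Num.Theory.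
Local Open Scope ring_scope.

Set Implicit Arguments.
Unset Strict Implicit.
Unset Printing Implicit Defensive.

Local Notation "1" := mone : monom_scope.
Local Notation "x * y" := (mmul x y) : monom_scope.

(** * Monomials *)

Section Monomials.
Variable I : choiceType.
Implicit Types (m n : cmonom I) (i j : I).

Lemma divcm_ucmM i m : divcm (ucm i * m)%M (ucm i) = m.
Proof. by apply/eqP/cmP=> j; rewrite divcmE cmM addKn. Qed.

Lemma ucmM_divcm i m : m i != 0%N -> (ucm i * divcm m (ucm i))%M = m.
Proof.
move=> mi0; apply/eqP/cmP=> j; rewrite cmM divcmE cmU.
by case: eqP => [<-|_]; rewrite ?subn0 // subnKC // lt0n.
Qed.

(** By total degree: a monomial other than [1] has a variable of positive exponent, and dividing it
    out lowers the degree by one. *)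
Lemma cmonom_ind (Pr : cmonom I -> Prop) :
  Pr 1%M -> (forall i m, Pr m -> Pr (ucm i * m)%M) -> forall m, Pr m.
Proof.
move=> P1 PU m; move: {2}(mdeg m) (leqnn (mdeg m)) => d.
elim: d m => [|d IH] m; first by rewrite leqn0 mdeg_eq0 => /eqP->.
have [->|] := eqVneq m 1%M; first by [].
move=> m1; have [i mi0] : exists i, m i != 0%N.
  have: finsupp m != fset0.
    apply: contraNneq m1 => m0; apply/eqP/mdeg_eq0I.
    by rewrite mdegE m0 big_seq_fset0.
  by case/fset0Pn=> i; rewrite -cmE_neq0; exists i.
rewrite -(ucmM_divcm mi0) mdegM mdegU add1n ltnS => le_d.
exact/PU/IH.
Qed.

End Monomials.

(* Locked, here and below: failed unification attempts would otherwise unfold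
   these definitions down to the finite maps underlying monomials. *)
HB.lock Definition sext (I : choiceType) (K S : nzRingType)
    (emb : {rmorphism K -> S}) (M : lmodType S) (f : cmonom I -> M)
    (P : mpol K I) : M :=
  \sum_(m <- msupp P) emb P@_m *: f m.

(** * Linear maps prescribed on monomials *)

Section LinearExtension.
Variables (I : choiceType) (K S : nzRingType) (emb : {rmorphism K -> S}).
Variable M : lmodType S.
Implicit Types (f g : cmonom I -> M) (P Q : mpol K I).

Local Notation sext := (sext emb).

Lemma sextE f P : sext f P = \sum_(m <- msupp P) emb P@_m *: f m.
Proof. by rewrite sext.unlock. Qed.

(** Enlarging the support only adds zero coefficients, so sums over different supports can be
    compared. *)
Lemma sextEw (d : {fset cmonom I}) f P :
  (msupp P `<=` d)%fset -> sext f P = \sum_(m <- d) emb P@_m *: f m.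
Proof.
move=> sPd; rewrite sextE; apply/big_fset_incl => // m _ mP.
by rewrite mcoeff_outdom // rmorph0 scale0r.
Qed.

Lemma sext_is_zmod_morphism f : zmod_morphism (sext f).
Proof.
move=> P Q; pose d := (msupp P `|` msupp Q)%fset.
rewrite (@sextEw d _ (P - Q)) ?msuppB_le // (@sextEw d _ P) ?fsubsetUl //.
rewrite (@sextEw d _ Q) ?fsubsetUr // -sumrB.
by apply: eq_bigr => m _; rewrite mcoeffB rmorphB scalerBl.
Qed.

HB.instance Definition _ f :=
  GRing.isZmodMorphism.Build (mpol K I) M (sext f) (sext_is_zmod_morphism f).

Lemma sextZ c f P : sext f (c *: P) = emb c *: sext f P.
Proof.
rewrite (sextEw _ (msuppZ_le c P)) sextE scaler_sumr.
by apply: eq_bigr => m _; rewrite mcoeffZ rmorphM scalerA.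
Qed.

Lemma sextU c f m : sext f << c *g m >> = emb c *: f m.
Proof. by rewrite (sextEw _ msuppU_le) big_seq_fset1 mcoeffUU. Qed.

Lemma sext_mmon f m : sext f (mmon m) = f m.
Proof. by rewrite sextU rmorph1 scale1r. Qed.

Lemma eq_sext f g P : f =1 g -> sext f P = sext g P.
Proof. by move=> fg; rewrite !sextE; apply: eq_bigr => m _; rewrite fg. Qed.

Lemma sextD f g P : sext (fun m => f m + g m) P = sext f P + sext g P.
Proof.
by rewrite !sextE -big_split; apply: eq_bigr => m _; rewrite scalerDr.
Qed.

End LinearExtension.

HB.instance Definition _ (I : choiceType) (S : nzRingType) (M : lmodType S)
    (f : cmonom I -> M) :=
  GRing.isScalable.Build S (mpol S I) M *:%R (sext idfun f)
    (fun c P => sextZ idfun c f P).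

(** * Expansion of polynomials in monomials, and substitution *)

Section Polynomials.
Variable I : choiceType.

Lemma mmon1 (K : nzRingType) : mmon (1%M : cmonom I) = 1 :> mpol K I.
Proof. by []. Qed.

Lemma counit_mmon (K : nzRingType) (m : cmonom I) :
  counit (mmon m : mpol K I) = (m == 1%M)%:R.
Proof. by rewrite /counit /mmon mcoeffU1. Qed.

Lemma mmonM (K : nzRingType) (m n : cmonom I) :
  mmon (m * n)%M = mmon m * mmon n :> mpol K I.
Proof. by rewrite malgM_def fgmulUU mulr1. Qed.

Lemma mpol_sum (K : nzRingType) (P : mpol K I) :
  P = \sum_(m <- msupp P) P@_m *: mmon m.
Proof.
rewrite {1}[P]monalgE; apply: eq_bigr => m _.
by apply/malgP => n; rewrite mcoeffZ /mmon [LHS]mcoeffU mcoeffU1 mulr_natr.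
Qed.

Lemma mpol_mmon_ind (K : nzRingType) (Pr : mpol K I -> Prop) :
  (forall c P Q, Pr P -> Pr Q -> Pr (c *: P + Q)) ->
  (forall m, Pr (mmon m)) -> forall P, Pr P.
Proof.
move=> PD Pm P; rewrite [P]mpol_sum.
(* [0] is reached through the closure property, as [- 1 + 1]. *)
have P0 : Pr 0 by rewrite -(addNr (mmon 1%M)) -scaleN1r; apply: PD.
apply: big_ind => // [Q1 Q2 h1 h2|m _].
  by rewrite -[Q1]scale1r; apply: PD.
by have := PD P@_m (mmon m) 0 (Pm m) P0; rewrite addr0.
Qed.

Lemma sext_mX (K : comNzRingType) (S : nzRingType) (emb : {rmorphism K -> S})
    (M : lmodType S) (f : cmonom I -> M) i (P : mpol K I) :
  sext emb f (mX i * P) = sext emb (fun m => f (ucm i * m)%M) P.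
Proof.
rewrite {1}[P]mpol_sum mulr_sumr raddf_sum sextE; apply: eq_bigr => m _.
by rewrite -scalerAr /= sextZ -[mX i]/(mmon (ucm i)) -mmonM sext_mmon.
Qed.

Lemma msubst_sext (K : comNzRingType) (J : choiceType) (f : I -> mpol K J) P :
  msubst f P = sext idfun (fun m => \prod_(i <- finsupp m) f i ^+ m i) P.
Proof. by rewrite sextE. Qed.

Lemma msubst_sum (K : comNzRingType) (J : choiceType) (f : I -> mpol K J) P :
  msubst f P = \sum_(m <- msupp P) P@_m *: msubst f (mmon m).
Proof.
rewrite msubst_sext {1}[P]mpol_sum raddf_sum; apply: eq_bigr => m _.
by rewrite msubst_sext /= sextZ.
Qed.

Lemma prod_finsuppEw (T : comNzRingType) (f : I -> T) (m : cmonom I)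
    (d : {fset I}) : (finsupp m `<=` d)%fset ->
  \prod_(i <- finsupp m) f i ^+ m i = \prod_(i <- d) f i ^+ m i.
Proof.
move=> sd; apply: big_fset_incl => // i _.
by rewrite -cmE_eq0 => /eqP->; rewrite expr0.
Qed.

Lemma prod_finsuppM (T : comNzRingType) (f : I -> T) (m n : cmonom I) :
  \prod_(i <- finsupp (m * n)%M) f i ^+ (m * n)%M i =
  (\prod_(i <- finsupp m) f i ^+ m i) * \prod_(i <- finsupp n) f i ^+ n i.
Proof.
rewrite (prod_finsuppEw f (d := finsupp m `|` finsupp n)%fset) ?mdomD //.
rewrite [in RHS](prod_finsuppEw f (fsubsetUl _ (finsupp n))).
rewrite [in RHS](prod_finsuppEw f (fsubsetUr (finsupp m) _)) -big_split.
by apply: eq_bigr => i _; rewrite cmM exprD.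
Qed.

Lemma msubst_mX (K : comNzRingType) (J : choiceType) (f : I -> mpol K J) i P :
  msubst f (mX i * P) = f i * msubst f P.
Proof.
rewrite !msubst_sext sext_mX !sextE mulr_sumr; apply: eq_bigr => m _.
rewrite prod_finsuppM mdomU big_seq_fset1 cmUU expr1.
by rewrite -scalerAr.
Qed.

Lemma msubst1 (K : comNzRingType) (J : choiceType) (f : I -> mpol K J) :
  msubst f 1 = 1.
Proof.
by rewrite msubst_sext -mmon1 sext_mmon mdom1 big_seq_fset0.
Qed.

End Polynomials.

(** * Coproducts of monomials *)

Section Slot.
Variable k : nat.
Implicit Types (m : cmonom (nat * 'I_k)%type) (j : 'I_k).

Lemma slotE m j i : slot m j i = m (i, j).
Proof.
rewrite /slot cmE fsfun_fun; case: ifP => // /negbT mi; apply/esym/eqP.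
rewrite cmE_eq0; apply: contra mi => mi; apply/imfsetP; by exists (i, j).
Qed.

Lemma slot1 j : slot 1%M j = 1%M.
Proof. by apply/eqP/cmP=> i; rewrite slotE !cm1. Qed.

Lemma slotU m i j j' :
  slot (ucm (i, j) * m)%M j' =
  if j == j' then (ucm i * slot m j')%M else slot m j'.
Proof.
apply/eqP/cmP=> i'; rewrite slotE cmM cmU xpair_eqE.
by have [_|_] := eqVneq j j'; rewrite ?cmM slotE ?cmU ?andbT ?andbF ?add0n.
Qed.

End Slot.

Lemma sum_ord2 (V : nmodType) (F : 'I_2 -> V) :
  \sum_j F j = F (@Ordinal 2 0 isT) + F (@Ordinal 2 1 isT).
Proof.
by rewrite !big_ord_recl big_ord0 addr0; congr (F _ + F _); apply: val_inj.
Qed.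

Lemma sum_ord3 (V : nmodType) (F : 'I_3 -> V) :
  \sum_j F j =
  F (@Ordinal 3 0 isT) + F (@Ordinal 3 1 isT) + F (@Ordinal 3 2 isT).
Proof.
rewrite !big_ord_recl big_ord0 addr0 addrA.
by congr (F _ + F _ + F _); apply: val_inj.
Qed.

HB.lock Definition cop2 (K : comNzRingType) (S : nzRingType)
    (emb : {rmorphism K -> S}) (M : lmodType S)
    (f : cmonom nat -> cmonom nat -> M) (m : cmonom nat) : M :=
  sext emb (fun x => f (slot x (@Ordinal 2 0 isT)) (slot x (@Ordinal 2 1 isT)))
    (Deltak 2 (mmon m)).

HB.lock Definition cop3 (K : comNzRingType) (S : nzRingType)
    (emb : {rmorphism K -> S}) (M : lmodType S)
    (h : cmonom nat -> cmonom nat -> cmonom nat -> M) (m : cmonom nat) : M :=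
  sext emb (fun x => h (slot x (@Ordinal 3 0 isT)) (slot x (@Ordinal 3 1 isT))
                       (slot x (@Ordinal 3 2 isT)))
    (Deltak 3 (mmon m)).

Section Coproduct.
Variables (K : comNzRingType) (S : nzRingType) (emb : {rmorphism K -> S}).

Lemma Deltak1 k : Deltak k 1 = 1 :> mpol K _.
Proof. exact: msubst1. Qed.

Lemma Deltak_mX k i (P : mpol K nat) :
  Deltak k (mX i * P) = (\sum_(j < k) mX (i, j)) * Deltak k P.
Proof. exact: msubst_mX. Qed.

Lemma Deltak_sum k (P : mpol K nat) :
  Deltak k P = \sum_(m <- msupp P) P@_m *: Deltak k (mmon m).
Proof. exact: msubst_sum. Qed.

Variable M : lmodType S.

Lemma sweedler_sum k (F : ('I_k -> mpol K nat) -> M) P :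
  sweedler emb F P = \sum_(m <- msupp P) emb P@_m *: sweedler emb F (mmon m).
Proof.
pose f m := F (fun j => mmon (slot m j)).
have sweedlerE Q : sweedler emb F Q = sext emb f (Deltak k Q) by rewrite sextE.
rewrite sweedlerE Deltak_sum raddf_sum.
by apply: eq_bigr => m _; rewrite /= sextZ sweedlerE.
Qed.

Implicit Types (f g : cmonom nat -> cmonom nat -> M)
  (h : cmonom nat -> cmonom nat -> cmonom nat -> M) (m : cmonom nat).

Local Notation cop2 := (cop2 emb).
Local Notation cop3 := (cop3 emb).

Lemma cop2_1 f : cop2 f 1%M = f 1%M 1%M.
Proof. by rewrite cop2.unlock mmon1 Deltak1 -mmon1 sext_mmon !slot1. Qed.

Lemma cop3_1 h : cop3 h 1%M = h 1%M 1%M 1%M.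
Proof. by rewrite cop3.unlock mmon1 Deltak1 -mmon1 sext_mmon !slot1. Qed.

(** Primitivity of [x_i]: the new variable enters exactly one of the slots. Together with [cop2_1]
    this opens identities about [cop2] to induction on monomials. *)
Lemma cop2U f i m :
  cop2 f (ucm i * m)%M =
  cop2 (fun a b => f (ucm i * a)%M b) m + cop2 (fun a b => f a (ucm i * b)%M) m.
Proof.
rewrite cop2.unlock mmonM Deltak_mX mulr_suml raddf_sum [LHS]sum_ord2.
by congr (_ + _); rewrite [LHS]sext_mX; apply: eq_sext => x; rewrite !slotU.
Qed.

Lemma cop3U h i m :
  cop3 h (ucm i * m)%M =
  cop3 (fun a b c => h (ucm i * a)%M b c) m +
  cop3 (fun a b c => h a (ucm i * b)%M c) m +
  cop3 (fun a b c => h a b (ucm i * c)%M) m.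
Proof.
rewrite cop3.unlock mmonM Deltak_mX mulr_suml raddf_sum [LHS]sum_ord3.
by congr (_ + _ + _); rewrite [LHS]sext_mX; apply: eq_sext => x; rewrite !slotU.
Qed.

Lemma eq_cop2 f g : f =2 g -> cop2 f =1 cop2 g.
Proof. by move=> fg m; rewrite cop2.unlock; apply: eq_sext => x; rewrite fg. Qed.

Lemma cop2D f g m : cop2 (fun a b => f a b + g a b) m = cop2 f m + cop2 g m.
Proof. by rewrite cop2.unlock -sextD. Qed.

Lemma cop2_eq0 f m : (forall a b, f a b = 0) -> cop2 f m = 0.
Proof.
by move=> f0; rewrite cop2.unlock sextE big1 // => x _; rewrite f0 scaler0.
Qed.

(** Coassociativity. The induction generalises over [h], because splitting off a variable shifts one
    of its arguments. *)
Lemma cop3_cop2 h m : cop3 h m = cop2 (fun a x => cop2 (h a) x) m.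
Proof.
elim/cmonom_ind: m h => [|i m IH] h; first by rewrite cop3_1 !cop2_1.
rewrite cop3U cop2U !IH -addrA; congr (_ + _).
by rewrite -cop2D; apply: eq_cop2 => a x; rewrite cop2U.
Qed.

Lemma eq_cop3 h h' : (forall a b c, h a b c = h' a b c) -> cop3 h =1 cop3 h'.
Proof. by move=> hh' m; rewrite cop3.unlock; apply: eq_sext => x; rewrite hh'. Qed.

End Coproduct.

(** Additivity of [phi] suffices, and the scalar rings may differ, because the coproduct of a
    monomial has natural-number coefficients. *)
Lemma raddf_cop2 (K : comNzRingType) (S S' : nzRingType)
    (emb : {rmorphism K -> S}) (emb' : {rmorphism K -> S'})
    (M : lmodType S) (M' : lmodType S') (phi : {additive M -> M'})
    (f : cmonom nat -> cmonom nat -> M) m :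
  phi (cop2 emb f m) = cop2 emb' (fun a b => phi (f a b)) m.
Proof.
elim/cmonom_ind: m f => [|i m IH] f; first by rewrite !cop2_1.
by rewrite !cop2U raddfD !IH.
Qed.

Lemma raddf_cop3 (K : comNzRingType) (S S' : nzRingType)
    (emb : {rmorphism K -> S}) (emb' : {rmorphism K -> S'})
    (M : lmodType S) (M' : lmodType S') (phi : {additive M -> M'})
    (h : cmonom nat -> cmonom nat -> cmonom nat -> M) m :
  phi (cop3 emb h m) = cop3 emb' (fun a b c => phi (h a b c)) m.
Proof.
rewrite !cop3_cop2 (raddf_cop2 _ emb'); apply: eq_cop2 => a x.
exact: raddf_cop2.
Qed.

(* The derivation [sum_i th_i d/dx_i], acting on functions of a monomial by
   transposition. *)
HB.lock Definition pder (M : zmodType) (th : nat -> {additive M -> M})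
    (f : cmonom nat -> M) (m : cmonom nat) : M :=
  \sum_(i <- finsupp m) th i (f (divcm m (ucm i))) *+ m i.

(** * Leibniz rules for transposed derivations *)

Section PartialDerivative.
Variables (M : zmodType).
Implicit Types (th : nat -> {additive M -> M}) (f g : cmonom nat -> M).

Lemma pder_big th f (m : cmonom nat) (v : seq nat) :
  uniq v -> {subset finsupp m <= v} ->
  pder th f m = \sum_(i <- v) th i (f (divcm m (ucm i))) *+ m i.
Proof.
move=> uv sv; rewrite pder.unlock [RHS](bigID (mem (finsupp m))) /= [X in _ + X]big1.
  rewrite addr0 -[RHS]big_filter; apply: perm_big; apply: uniq_perm.
  - exact: fset_uniq.
  - exact: filter_uniq.
  - by move=> i; rewrite mem_filter andb_idr //; apply: sv.
by move=> i; rewrite -cmE_eq0 => /eqP->.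
Qed.

Lemma pder1 th f : pder th f 1%M = 0.
Proof. by rewrite pder.unlock mdom1 big_seq_fset0. Qed.

Lemma pderU th f i m :
  pder th f (ucm i * m)%M = th i (f m) + pder th (fun x => f (ucm i * x)%M) m.
Proof.
rewrite [LHS](_ : _ = \sum_(j <- finsupp (ucm i * m)%M)
    th j (f (divcm (ucm i * m)%M (ucm j))) *+ (ucm i * m)%M j); last first.
  by rewrite pder.unlock.
(* Both sides are summed over the support of [x_i m]; an additional variable has exponent zero in
   [m]. *)
rewrite [in RHS](@pder_big _ _ _ (finsupp (ucm i * m)%M)); first last.
- by move=> j; rewrite mdomD inE orbC => ->.
- exact: fset_uniq.
transitivity (\sum_(j <- finsupp (ucm i * m)%M)
    (th j (f (divcm (ucm i * m)%M (ucm j))) *+ ucm i j +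
     th j (f (divcm (ucm i * m)%M (ucm j))) *+ m j)).
  by apply: eq_bigr => j _; rewrite cmM mulrnDr.
rewrite big_split /=; congr (_ + _).
  rewrite (big_fsetD1 i) /=; last by rewrite mdomD mdomU !inE eqxx.
  rewrite cmUU divcm_ucmM big1_fset ?addr0 // => j.
  by rewrite !inE cmU eq_sym => /andP[/negPf->].
(* Division truncates at exponent zero: it commutes with multiplication by [x_i] when [x_j] divides
   [m], and otherwise the coefficient is zero. *)
apply: eq_bigr => j _; have [->|mj] := eqVneq (m j) 0%N; first by rewrite !mulr0n.
congr (th j (f _) *+ _); apply/eqP/cmP=> l.
rewrite !(divcmE, cmM, cmU); have [<-|_] := eqVneq j l; last by rewrite !subn0.
by rewrite addnBA // lt0n.
Qed.

Lemma eq_pder th f g : f =1 g -> pder th f =1 pder th g.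
Proof. by move=> fg m; rewrite pder.unlock; apply: eq_bigr => i _; rewrite fg. Qed.

Lemma pderD th f g m : pder th (fun x => f x + g x) m = pder th f m + pder th g m.
Proof.
by rewrite pder.unlock -big_split; apply: eq_bigr => i _; rewrite raddfD mulrnDl.
Qed.

Lemma pderDth th th' th'' f m : (forall i x, th'' i x = th i x + th' i x) ->
  pder th f m + pder th' f m = pder th'' f m.
Proof.
move=> thD; rewrite pder.unlock -big_split.
by apply: eq_bigr => i _; rewrite thD mulrnDl.
Qed.

Lemma pderM th f m n :
  pder th f (m * n)%M =
  pder th (fun x => f (x * n)%M) m + pder th (fun x => f (m * x)%M) n.
Proof.
elim/cmonom_ind: m f => [|i m IH] f.
  by rewrite pder1 add0r mul1m; apply: eq_pder => x; rewrite mul1m.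
rewrite -mulmA pderU IH pderU -addrA; congr (_ + (_ + _)); apply: eq_pder => x.
  by rewrite mulmA.
by rewrite mulmA.
Qed.

End PartialDerivative.

Lemma raddf_pder (M M' : zmodType) (phi : {additive M -> M'})
    (th : nat -> {additive M -> M}) (th' : nat -> {additive M' -> M'}) f m :
  (forall i x, phi (th i x) = th' i (phi x)) ->
  phi (pder th f m) = pder th' (fun x => phi (f x)) m.
Proof.
move=> phi_th; rewrite pder.unlock [LHS]raddf_sum; apply: eq_bigr => i _.
by rewrite raddfMn phi_th.
Qed.

(** * Derivations and the coproduct *)

Section Coderivation.
Variables (K : comNzRingType) (S : nzRingType) (emb : {rmorphism K -> S}).
Variables (M : lmodType S) (th : nat -> {additive M -> M}).
Implicit Types f : cmonom nat -> cmonom nat -> M.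
Local Notation cop2 := (cop2 emb).

(** Translation invariance of a constant-coefficient derivation [D]: [(D (x) id) Delta = Delta D],
    tested against [f]. *)
Lemma cop2_pderl f m :
  cop2 (fun a b => pder th (fun x => f x b) a) m = pder th (cop2 f) m.
Proof.
elim/cmonom_ind: m f => [|i m IH] f; first by rewrite cop2_1 !pder1.
rewrite cop2U pderU IH.
under eq_cop2 => a b do rewrite pderU.
rewrite cop2D IH (raddf_cop2 emb emb) -addrA -pderD; congr (_ + _).
by apply: eq_pder => x; rewrite cop2U.
Qed.

Lemma cop2_pderr f m :
  cop2 (fun a b => pder th (f a) b) m = pder th (cop2 f) m.
Proof.
elim/cmonom_ind: m f => [|i m IH] f; first by rewrite cop2_1 !pder1.
rewrite cop2U pderU IH.
under [X in _ + X]eq_cop2 => a b do rewrite pderU.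
rewrite cop2D IH (raddf_cop2 emb emb) addrCA -pderD; congr (_ + _).
by apply: eq_pder => x; rewrite cop2U.
Qed.

(** The Sweedler sum and the derivation concern independent arguments and are both additive in [f],
    so they commute. *)
Lemma cop2_pder_comm (f : cmonom nat -> cmonom nat -> cmonom nat -> M) m n :
  cop2 (fun a b => pder th (f a b) n) m =
  pder th (fun x => cop2 (fun a b => f a b x) m) n.
Proof.
elim/cmonom_ind: m f => [|i m IH] f.
  by rewrite cop2_1; apply: eq_pder => x; rewrite cop2_1.
by rewrite cop2U !IH -pderD; apply: eq_pder => x; rewrite cop2U.
Qed.

Implicit Types h : cmonom nat -> cmonom nat -> cmonom nat -> M.
Local Notation cop3 := (cop3 emb).

Lemma pder_cop3 h m :
  pder th (cop3 h) m = pder th (cop2 (fun a x => cop2 (h a) x)) m.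
Proof. by apply: eq_pder => x; apply: cop3_cop2. Qed.

(** Coassociativity reduces a derivation of one of three slots to the binary rules. *)
Lemma cop3_pder1 h m :
  cop3 (fun a b c => pder th (fun x => h x b c) a) m = pder th (cop3 h) m.
Proof.
rewrite cop3_cop2 pder_cop3 -cop2_pderl; apply: eq_cop2 => a x.
exact: (cop2_pder_comm (fun b c y => h y b c)).
Qed.

Lemma cop3_pder2 h m :
  cop3 (fun a b c => pder th (fun x => h a x c) b) m = pder th (cop3 h) m.
Proof.
rewrite cop3_cop2 pder_cop3 -cop2_pderr; apply: eq_cop2 => a x.
exact: cop2_pderl.
Qed.

Lemma cop3_pder3 h m :
  cop3 (fun a b c => pder th (h a b) c) m = pder th (cop3 h) m.
Proof.
rewrite cop3_cop2 pder_cop3 -cop2_pderr; apply: eq_cop2 => a x.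
exact: cop2_pderr.
Qed.

End Coderivation.

Lemma sw2_id (K : comNzRingType) (M : lmodType K)
    (F : mpol K nat -> mpol K nat -> M) m :
  sw2 id F (mmon m) = cop2 idfun (fun a b => F (mmon a) (mmon b)) m.
Proof. by rewrite cop2.unlock sextE. Qed.

Lemma sw2_alg (K : comNzRingType) (A : algType K) (M : lmodType A)
    (F : mpol K nat -> mpol K nat -> M) m :
  sw2 (fun c : K => c%:A) F (mmon m) =
  cop2 (GRing.in_alg A) (fun a b => F (mmon a) (mmon b)) m.
Proof. by rewrite cop2.unlock sextE. Qed.

Lemma sw3_alg (K : comNzRingType) (A : algType K) (M : lmodType A)
    (F : mpol K nat -> mpol K nat -> mpol K nat -> M) m :
  sw3 (fun c : K => c%:A) F (mmon m) =
  cop3 (GRing.in_alg A) (fun a b c => F (mmon a) (mmon b) (mmon c)) m.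
Proof. by rewrite cop3.unlock sextE. Qed.

Lemma sw3_alg_sum (K : comNzRingType) (A : algType K) (M : lmodType A)
    (F : mpol K nat -> mpol K nat -> mpol K nat -> M) P :
  sw3 (fun c : K => c%:A) F P =
  \sum_(m <- msupp P) (P@_m)%:A *: sw3 (fun c : K => c%:A) F (mmon m).
Proof. exact: (sweedler_sum (GRing.in_alg A)). Qed.

(** * Bicharacters on monomials *)

(** Coefficients in the form expected by [pder], which then becomes the transpose of
    [sum_n q_n d/dx_n]; [mulby] serves functions with values in [A] itself. *)
Definition scaleby (A : nzRingType) (M : lmodType A) (q : nat -> A) (n : nat) :
  {additive M -> M} := *:%R (q n).

Definition mulby (A : nzRingType) (q : nat -> A) (n : nat) :
  {additive A -> A} := GRing.mull_fun (q n) idfun.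

Section MonomialBicharacter.
Variables (K : comNzRingType) (A : comAlgType K).
Implicit Types (rho : cmonom nat -> cmonom nat -> A) (a b c m : cmonom nat).
Local Notation copK := (@cop2 K K idfun A).

(** The bicharacter axioms for a bilinear map recorded by its values on the monomial basis. *)
Definition mbichar rho : Prop :=
  [/\ forall a, rho 1%M a = (a == 1%M)%:R /\ rho a 1%M = (a == 1%M)%:R,
      forall a b c, rho (a * b)%M c = copK (fun c1 c2 => rho a c1 * rho b c2) c &
      forall a b c, rho a (b * c)%M = copK (fun a1 a2 => rho a1 b * rho a2 c) a].

Definition mtransp rho a b := rho b a.

Definition mconvo rho rho' a b : A :=
  copK (fun a1 a2 => copK (fun b1 b2 => rho a1 b1 * rho' a2 b2) b) a.

Definition qrow rho i j : A := rho (ucm i) (ucm j).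

(** For a bicharacter this is the value of the symmetrization on [x_i (x) x_j]. *)
Definition symq rho i j : A := qrow rho i j + qrow rho j i.

Lemma mbichar_transp rho : mbichar rho -> mbichar (mtransp rho).
Proof.
case=> r1 rMl rMr; split=> [a|a b c|a b c]; rewrite /mtransp //.
by case: (r1 a).
Qed.

(** The counit law [sum eta(m') m'' = m], tested against [g]. *)
Lemma cop2_unitl (g : cmonom nat -> A) m :
  copK (fun x y => (x == 1%M)%:R * g y) m = g m.
Proof.
elim/cmonom_ind: m g => [|j x IH] g; first by rewrite cop2_1 eqxx mul1r.
rewrite cop2U (IH (fun y => g (ucm j * y)%M)).
by rewrite cop2_eq0 ?add0r // => y z; rewrite cmM_eq1 cm1_eq1 mul0r.
Qed.

(** Since [r(x_i (x) -)] sees only degree one, the Sweedler sum for [r(x_i a (x) b)] removes exactly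
    one variable from [b]. *)
Lemma mbicharU rho i a b : mbichar rho ->
  rho (ucm i * a)%M b = pder (mulby (qrow rho i)) (rho a) b.
Proof.
case=> r1 rMl rMr; rewrite rMl.
(* The primitive [x_i] meets either [x_j] or [x], and the other factor is paired with [1]; pairing
   [x_j] with [1] gives zero. *)
have rX j x : rho (ucm i) (ucm j * x)%M = qrow rho i j * (x == 1%M)%:R.
  rewrite rMr -[X in copK _ X]mulm1 cop2U !cop2_1 !mulm1 !(proj1 (r1 _)).
  by rewrite cm1_eq1 mul0r addr0.
(* [rho a] becomes an arbitrary [g], because the induction shifts its argument. *)
elim/cmonom_ind: b (rho a) => [|j b IH] g.
  by rewrite cop2_1 pder1 (proj2 (r1 _)) cm1_eq1 mul0r.
rewrite cop2U pderU -IH; congr (_ + _).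
(* [g b] is expanded by the counit law into a Sweedler sum that matches the left-hand side term by
   term. *)
rewrite /= -[in RHS](cop2_unitl g) -[RHS]/(mulby (qrow rho i) j _).
rewrite (raddf_cop2 _ idfun).
by apply: eq_cop2 => x y; rewrite rX /= mulrA.
Qed.

Lemma mconvo1 rho b : mbichar rho ->
  mconvo rho (mtransp rho) 1%M b = (b == 1%M)%:R.
Proof.
case=> r1 _ _; rewrite /mconvo cop2_1 /mtransp.
rewrite (eq_cop2 _ (g := fun x y => (x == 1%M)%:R * (y == 1%M)%:R)) //.
  exact: cop2_unitl.
by move=> x y; rewrite (proj1 (r1 _)) (proj2 (r1 _)).
Qed.

(** The variable [x_i] goes to [r] or to its transpose. By [mbicharU] it becomes a derivation of one
    slot of [b], with coefficients [q_ij] or [q_ji], hence a derivation of [b]; the two add up. *)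
Lemma mconvoU rho i a b : mbichar rho ->
  mconvo rho (mtransp rho) (ucm i * a)%M b =
  pder (mulby (symq rho i)) (mconvo rho (mtransp rho) a) b.
Proof.
move=> hr; have htr := mbichar_transp hr.
pose th := mulby (qrow rho i); pose th' := mulby (qrow (mtransp rho) i).
rewrite -(pderDth (th := th) (th' := th')); last by move=> j x; rewrite /= mulrDl.
have pder_conv (th0 : nat -> {additive A -> A}) :
  pder th0 (mconvo rho (mtransp rho) a) b =
  copK (fun a1 a2 =>
    pder th0 (copK (fun b1 b2 => rho a1 b1 * mtransp rho a2 b2)) b) a.
  exact: esym (cop2_pder_comm idfun th0 (fun a1 a2 =>
    copK (fun b1 b2 => rho a1 b1 * mtransp rho a2 b2)) a b).
rewrite !pder_conv [LHS]cop2U.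
congr (_ + _); apply: eq_cop2 => a1 a2.
  rewrite -cop2_pderl; apply: eq_cop2 => b1 b2; rewrite mbicharU //.
  rewrite -[LHS]/(GRing.mulr_fun (mtransp rho a2 b2) idfun _).
  by rewrite (raddf_pder (th' := th)) // => j x; rewrite /= mulrA.
rewrite -cop2_pderr; apply: eq_cop2 => b1 b2; rewrite mbicharU //.
rewrite -[LHS]/(GRing.mull_fun (rho a1 b1) idfun _).
by rewrite (raddf_pder (th' := th')) // => j x; rewrite /= mulrCA.
Qed.

End MonomialBicharacter.

Section ScaleVector.
Variables (A : nzRingType) (M : lmodType A).

(** Additive in the scalar, so [raddf_pder] carries derivations of [A]-valued functions over to
    vector-valued ones. *)
Definition scalev (v : M) (x : A) : M := x *: v.

Lemma scalev_is_zmod_morphism v : zmod_morphism (scalev v).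
Proof. by move=> x y; apply: scalerBl. Qed.

HB.instance Definition _ v :=
  GRing.isZmodMorphism.Build A M (scalev v) (scalev_is_zmod_morphism v).

End ScaleVector.

(* The operators on [mpol A nat] are studied on an abstract algebra [V] carrying
   the structure of a polynomial algebra: unification does not terminate in
   practice on the concrete ring operations of [mpol A nat]. *)
Record polynomial_basis (A : comNzRingType) (V : comAlgType A)
    (mon : cmonom nat -> V) : Prop := PolynomialBasis {
  mon1 : mon 1%M = 1;
  monM : forall m n, mon (m * n)%M = mon m * mon n;
  mon_ind : forall Pr : V -> Prop,
    (forall c P Q, Pr P -> Pr Q -> Pr (c *: P + Q)) ->
    (forall m, Pr (mon m)) -> forall P, Pr P;
}.

(** * Constant-coefficient derivations *)

Section Derivations.
Variables (A : comNzRingType) (V : comAlgType A) (mon : cmonom nat -> V).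
Hypothesis monV : polynomial_basis mon.
Variable lext : (cmonom nat -> V) -> {linear V -> V}.
Hypothesis lext_mon : forall f m, lext f (mon m) = f m.
Implicit Types (q : nat -> A) (P Q : V) (m : cmonom nat).
Local Notation xv i := (mon (ucm i)).

Lemma mon_indX (Pr : V -> Prop) :
  Pr 1 -> (forall c P Q, Pr P -> Pr Q -> Pr (c *: P + Q)) ->
  (forall i P, Pr P -> Pr (xv i * P)) -> forall P, Pr P.
Proof.
move=> P1 PD PX; apply: (mon_ind monV) => [|m]; first exact: PD.
elim/cmonom_ind: m => [|i m IH]; first by rewrite (mon1 monV).
by rewrite (monM monV); apply: PX.
Qed.

Definition Dq q : {linear V -> V} := lext (pder (@scaleby A V q) mon).

Lemma Dq_mon q m : Dq q (mon m) = pder (@scaleby A V q) mon m.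
Proof. exact: lext_mon. Qed.

Lemma Dq1 q : Dq q 1 = 0.
Proof. by rewrite -(mon1 monV) Dq_mon pder1. Qed.

(** The commutation relation [[D_q, x_i] = q_i], which together with [Dq1] determines the linear map
    [D_q]. *)
Lemma Dq_X q i P : Dq q (xv i * P) = q i *: P + xv i * Dq q P.
Proof.
elim/(mon_ind monV): P => [c P Q hP hQ|m].
  rewrite mulrDr -scalerAr !linearP hP hQ mulrDr -scalerAr !scalerDr !scalerA.
  by rewrite [c * q i]mulrC addrACA.
rewrite -(monM monV) !Dq_mon pderU; congr (_ + _).
rewrite -[RHS]/(GRing.mull_fun (xv i) idfun _) (raddf_pder (th' := @scaleby A V q)).
  by apply: eq_pder => x; rewrite (monM monV).
by move=> j x; rewrite /= scalerAr.
Qed.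

Lemma Dq_comm q q' P : Dq q (Dq q' P) = Dq q' (Dq q P).
Proof.
elim/mon_indX: P => [|c P Q hP hQ|i P hP].
- by rewrite !Dq1 !linear0.
- by rewrite !linearP hP hQ.
by rewrite !Dq_X !linearP !Dq_X hP addrCA.
Qed.

End Derivations.

(** * The bullet product *)

HB.lock Definition mbullet (K : comNzRingType) (A : comAlgType K)
    (V : comAlgType A) (mon : cmonom nat -> V)
    (sigma : cmonom nat -> cmonom nat -> A) (a b : cmonom nat) : V :=
  cop2 (GRing.in_alg A) (fun a1 a2 =>
    cop2 (GRing.in_alg A) (fun b1 b2 => sigma a2 b2 *: mon (a1 * b1)%M) b) a.

Section Bullet.
Variables (K : comNzRingType) (A : comAlgType K) (V : comAlgType A).
Variable mon : cmonom nat -> V.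
Hypothesis monV : polynomial_basis mon.
Variable lext : (cmonom nat -> V) -> {linear V -> V}.
Hypothesis lext_mon : forall f m, lext f (mon m) = f m.
Local Notation xv i := (mon (ucm i)).
Local Notation copA := (@cop2 K A (GRing.in_alg A) V).
Local Notation th q := (@scaleby A V q).
Local Notation Dq := (Dq mon lext).
Variables (sigma : cmonom nat -> cmonom nat -> A) (q : nat -> nat -> A).
Hypothesis sigma1 : forall b, sigma 1%M b = (b == 1%M)%:R.
Hypothesis sigmaU : forall i a b,
  sigma (ucm i * a)%M b = pder (mulby (q i)) (sigma a) b.
Implicit Types (a b m : cmonom nat) (P Q : V).
Local Notation mbullet := (mbullet mon sigma).

(** Only the term with [b'' = 1] survives, because [sigma 1] is the counit. *)
Lemma mbullet1 b : mbullet 1%M b = mon b.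
Proof.
rewrite mbullet.unlock cop2_1.
elim/cmonom_ind: b => [|i b IH].
  by rewrite cop2_1 sigma1 eqxx scale1r mul1m.
rewrite cop2U [X in _ + X]cop2_eq0; last first.
  by move=> x y; rewrite sigma1 cmM_eq1 cm1_eq1 scale0r.
rewrite addr0 (monM monV) -IH -[RHS]/(GRing.mull_fun (xv i) idfun _).
rewrite (raddf_cop2 _ (GRing.in_alg A)); apply: eq_cop2 => x y.
by rewrite /= -scalerAr -(monM monV) !mul1m.
Qed.

(** In the slot [a'] the variable multiplies the result; in the slot [a''] it enters the pairing,
    where [sigmaU] turns it into a derivation of [b]. *)
Lemma mbulletU i a b :
  mbullet (ucm i * a)%M b = xv i * mbullet a b + pder (th (q i)) (mbullet a) b.
Proof.
rewrite mbullet.unlock cop2U; congr (_ + _).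
  rewrite -[RHS]/(GRing.mull_fun (xv i) idfun _).
  rewrite (raddf_cop2 _ (GRing.in_alg A)); apply: eq_cop2 => a1 a2.
  rewrite (raddf_cop2 _ (GRing.in_alg A)); apply: eq_cop2 => b1 b2.
  by rewrite /= -scalerAr -(monM monV) mulmA.
rewrite -[RHS](cop2_pder_comm (GRing.in_alg A) (th (q i))
  (fun a1 a2 => copA (fun b1 b2 => sigma a2 b2 *: mon (a1 * b1)%M)) a b).
apply: eq_cop2 => a1 a2; rewrite -cop2_pderr; apply: eq_cop2 => b1 b2.
rewrite sigmaU -[LHS]/(scalev (mon (a1 * b1)%M) _).
rewrite [LHS](raddf_pder (th' := th (q i))); last first.
  by move=> j x; rewrite /= /scalev scalerA.
exact: eq_pder.
Qed.

(** The derivation acts on the factor [a' b'] by the Leibniz rule, and a derivation of one slot of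
    [a] or [b] is a derivation of the whole. *)
Lemma Dq_mbullet q' a b :
  Dq q' (mbullet a b) =
  pder (th q') (mbullet^~ b) a + pder (th q') (mbullet a) b.
Proof.
rewrite mbullet.unlock.
rewrite -(cop2_pderl (GRing.in_alg A) (th q') (fun a1 a2 =>
   copA (fun b1 b2 => sigma a2 b2 *: mon (a1 * b1)%M) b)).
rewrite -(cop2_pder_comm (GRing.in_alg A) (th q')
  (fun a1 a2 => copA (fun b1 b2 => sigma a2 b2 *: mon (a1 * b1)%M)) a b).
rewrite -cop2D (raddf_cop2 _ (GRing.in_alg A)); apply: eq_cop2 => a1 a2.
rewrite -(cop2_pder_comm (GRing.in_alg A) (th q') (fun b1 b2 x =>
  sigma a2 b2 *: mon (x * b1)%M)) -cop2_pderl -cop2D.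
rewrite (raddf_cop2 _ (GRing.in_alg A)); apply: eq_cop2 => b1 b2.
rewrite /= linearZ /= Dq_mon // pderM scalerDr.
have th_scale j x : sigma a2 b2 *: th q' j x = th q' j (sigma a2 b2 *: x).
  by rewrite /= !scalerA mulrC.
congr (_ + _); rewrite -[LHS]/( *:%R (sigma a2 b2) _).
  by rewrite [LHS](raddf_pder (th' := th q')).
by rewrite [LHS](raddf_pder (th' := th q')).
Qed.

Variable bul : V -> V -> V.
Hypothesis bul_linl : forall Q c P P',
  bul (c *: P + P') Q = c *: bul P Q + bul P' Q.
Hypothesis bul_linr : forall P c Q Q',
  bul P (c *: Q + Q') = c *: bul P Q + bul P Q'.
Hypothesis bul_mon : forall a b, bul (mon a) (mon b) = mbullet a b.

Lemma bul1 Q : bul 1 Q = Q.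
Proof.
elim/(mon_ind monV): Q => [c P Q hP hQ|m]; first by rewrite bul_linr hP hQ.
by rewrite -(mon1 monV) bul_mon mbullet1.
Qed.

(** In its second argument [bul] is the linear extension of [mbullet a], and derivations pass
    through linear maps. *)
Lemma bul_pder q' a b :
  bul (mon a) (pder (th q') mon b) = pder (th q') (mbullet a) b.
Proof.
have bulE P : bul (mon a) P = lext (mbullet a) P.
  elim/(mon_ind monV): P => [c P Q hP hQ|m]; first by rewrite bul_linr linearP hP hQ.
  by rewrite bul_mon lext_mon.
rewrite bulE (raddf_pder (th' := th q')).
  by apply: eq_pder => x; rewrite /= lext_mon.
by move=> j x; rewrite /= linearZ.
Qed.

Lemma pder_bul q' a b :
  bul (pder (th q') mon a) (mon b) = pder (th q') (mbullet^~ b) a.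
Proof.
have bulE P : bul P (mon b) = lext (mbullet^~ b) P.
  elim/(mon_ind monV): P => [c P Q hP hQ|m]; first by rewrite bul_linl linearP hP hQ.
  by rewrite bul_mon lext_mon.
rewrite bulE (raddf_pder (th' := th q')).
  by apply: eq_pder => x; rewrite /= lext_mon.
by move=> j x; rewrite /= linearZ.
Qed.

Lemma bul_X i P Q : bul (xv i * P) Q = xv i * bul P Q + bul P (Dq (q i) Q).
Proof.
elim/(mon_ind monV): P => [c P P' hP hP'|a].
  rewrite mulrDr -scalerAr !bul_linl hP hP' mulrDr -scalerAr scalerDr.
  exact: addrACA.
elim/(mon_ind monV): Q => [c Q Q' hQ hQ'|b].
  rewrite linearP !bul_linr hQ hQ' mulrDr -scalerAr scalerDr.
  exact: addrACA.
by rewrite -(monM monV) Dq_mon // bul_pder !bul_mon mbulletU.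
Qed.

Lemma Dq_bul q' P Q : Dq q' (bul P Q) = bul (Dq q' P) Q + bul P (Dq q' Q).
Proof.
elim/(mon_ind monV): P => [c P P' hP hP'|a].
  rewrite bul_linl !linearP !bul_linl hP hP' scalerDr; exact: addrACA.
elim/(mon_ind monV): Q => [c Q Q' hQ hQ'|b].
  rewrite bul_linr !linearP !bul_linr hQ hQ' scalerDr; exact: addrACA.
by rewrite !Dq_mon // bul_pder pder_bul bul_mon Dq_mbullet.
Qed.

(** The operator [L_i]; by [bul1] and [bul_X] it is bullet multiplication by [x_i]. *)
Definition Xop i P := xv i * P + Dq (q i) P.

(** The derivative terms from [bul_X] and from [Xop] combine by the Leibniz rule [Dq_bul]. This is
    associativity of the bullet product when the first factor is a variable. *)
Lemma bul_Xop i P Q : bul (Xop i P) Q = Xop i (bul P Q).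
Proof.
rewrite /Xop -[xv i * P]scale1r bul_linl scale1r bul_X Dq_bul -!addrA.
by congr (_ + _); apply: addrC.
Qed.

End Bullet.

(** * The exponential of a second-order operator *)

Section Exponential.
Variables (K : comNzRingType) (A : comAlgType K) (V : comAlgType A).
Variable mon : cmonom nat -> V.
Hypothesis monV : polynomial_basis mon.
Variable lext : (cmonom nat -> V) -> {linear V -> V}.
Hypothesis lext_mon : forall f m, lext f (mon m) = f m.
Local Notation xv i := (mon (ucm i)).
Local Notation Dq := (Dq mon lext).
Variable rho : cmonom nat -> cmonom nat -> A.
Hypothesis rhoB : mbichar rho.
Local Notation sq := (symq rho).
Local Notation Xop := (Xop mon lext sq).
Implicit Types (a b m : cmonom nat) (P Q : V).

Variable lap : {linear V -> V}.
Hypothesis lap1 : lap 1 = 0.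
Hypothesis lapX : forall i P, lap (xv i * P) = xv i * lap P + Dq (sq i) P.

Lemma lap_Dq q P : lap (Dq q P) = Dq q (lap P).
Proof.
elim/(mon_indX monV): P => [|c P Q hP hQ|i P hP].
- by rewrite lap1 Dq1 // !linear0.
- by rewrite !linearP hP hQ.
rewrite Dq_X // lapX !linearD linearZ lapX hP Dq_X // -!addrA.
by rewrite (Dq_comm monV lext_mon q).
Qed.

Lemma iter_lap_lin k c P Q :
  iter k lap (c *: P + Q) = c *: iter k lap P + iter k lap Q.
Proof. by elim: k => //= k ->; rewrite linearP. Qed.

(** The commutator of [lap] with [x_i] is [D_i], which itself commutes with [lap], so [[lap^k, x_i]
    = k D_i lap^(k-1)]. At [k = 0] the truncated predecessor has coefficient zero. *)
Lemma iter_lapX k i P :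
  iter k lap (xv i * P) =
  xv i * iter k lap P + Dq (sq i) (iter k.-1 lap P) *+ k.
Proof.
elim: k => [|k IH]; first by rewrite mulr0n addr0.
rewrite iterS IH linearD lapX linearMn lap_Dq -addrA mulrS; congr (_ + (_ + _)).
by case: k {IH}.
Qed.

(** A generous bound, as [lap] lowers the degree by two, but one that [iter_lapX] propagates
    directly: both of its terms vanish by induction. *)
Lemma iter_lap_mon k m : (mdeg m < k)%N -> iter k lap (mon m) = 0.
Proof.
elim/cmonom_ind: m k => [|i m IH] [|k] //.
  by move=> _; rewrite (mon1 monV) iterSr lap1; elim: k => //= k ->; rewrite linear0.
rewrite mdegM mdegU add1n ltnS => lt_mk; rewrite (monM monV) iter_lapX.
by rewrite !IH ?linear0 ?mul0rn ?mulr0 ?addr0 // ltnW.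
Qed.

Lemma iter_lap_sum k (s : seq (cmonom nat)) (c : cmonom nat -> A) :
  (forall m, m \in s -> (mdeg m < k)%N) ->
  iter k lap (\sum_(m <- s) c m *: mon m) = 0.
Proof.
elim: s => [|m s IH] lt_k.
  by rewrite big_nil; elim: k {lt_k} => //= k ->; rewrite linear0.
rewrite big_cons iter_lap_lin IH ?addr0 => [|m' m's].
  by rewrite iter_lap_mon ?scaler0 // lt_k ?mem_head.
by rewrite lt_k // inE m's orbT.
Qed.

Variable w : nat -> A.
Hypothesis w0 : w 0 = 1.
Hypothesis wS : forall k, w k.+1 *+ k.+1 = w k.

Definition expn_lap n P : V := \sum_(k < n) w k *: iter k lap P.

(** With [w k] in the role of [1/k!], the relation [k w_k = w_(k-1)] turns the commutators of the
    powers into the series again, one term shorter. *)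
Lemma expn_lapX n i P :
  expn_lap n.+1 (xv i * P) =
  xv i * expn_lap n.+1 P + Dq (sq i) (expn_lap n P).
Proof.
rewrite /expn_lap mulr_sumr raddf_sum.
transitivity (\sum_(k < n.+1) (xv i * (w k *: iter k lap P) +
   (w k *+ k) *: Dq (sq i) (iter k.-1 lap P))).
  apply: eq_bigr => k _; rewrite iter_lapX scalerDr scalerAr.
  by rewrite -scalerMnr scalerMnl.
rewrite big_split /=; congr (_ + _).
(* The term [k = 0] has coefficient zero; dropping it shifts the index. *)
rewrite big_ord_recl /= mulr0n scale0r add0r; apply: eq_bigr => k _.
by rewrite wS linearZ.
Qed.

Variable sz : V -> nat.
Hypothesis sz_iter : forall P k, (sz P <= k)%N -> iter k lap P = 0.

Definition exp_lap P : V := expn_lap (sz P) P.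

(** The truncation order can be raised freely, which brings series of different polynomials to a
    common order. *)
Lemma exp_lapE n P : (sz P <= n)%N -> exp_lap P = expn_lap n P.
Proof.
move=> le_n; rewrite /exp_lap /expn_lap -(subnKC le_n) big_split_ord /=.
by rewrite [X in _ + X]big1 ?addr0 // => k _; rewrite sz_iter ?scaler0 ?leq_addr.
Qed.

Lemma exp_lap_lin c P Q : exp_lap (c *: P + Q) = c *: exp_lap P + exp_lap Q.
Proof.
pose n := maxn (sz (c *: P + Q)) (maxn (sz P) (sz Q)).
rewrite !(@exp_lapE n) ?leq_max ?leqnn ?orbT // /expn_lap scaler_sumr -big_split.
apply: eq_bigr => k _; rewrite iter_lap_lin scalerDr !scalerA.
by rewrite [w k * c]mulrC.
Qed.

Lemma exp_lap_sum (s : seq (cmonom nat)) (c : cmonom nat -> A) :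
  exp_lap (\sum_(m <- s) c m *: mon m) = \sum_(m <- s) c m *: exp_lap (mon m).
Proof.
elim: s => [|m s IH]; last by rewrite !big_cons exp_lap_lin IH.
(* The empty sum: linearity on [- 1 + 1] gives the value at [0]. *)
by have := exp_lap_lin (-1) 1 1; rewrite !scaleN1r !addNr !big_nil.
Qed.

Lemma exp_lapX i P : exp_lap (xv i * P) = Xop i (exp_lap P).
Proof.
pose n := maxn (sz (xv i * P)) (sz P).
(* [expn_lapX] truncates its terms at orders [n + 1] and [n], both admissible by the choice of
   [n]. *)
rewrite (@exp_lapE n.+1) ?leqW ?leq_max ?leqnn // expn_lapX /Xop.
by rewrite -!exp_lapE ?leqW // leq_max leqnn orbT.
Qed.

Lemma exp_lap1 : exp_lap 1 = 1.
Proof.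
(* A positive order, so that the term [k = 0] can be split off. *)
rewrite (@exp_lapE (sz 1).+1) // /expn_lap big_ord_recl w0 scale1r big1 ?addr0 //.
move=> k _; rewrite (_ : iter _ lap 1 = 0) ?scaler0 //.
by have := @iter_lap_mon k.+1 1%M; rewrite mdeg1 (mon1 monV); apply.
Qed.

Lemma exp_lap_xv i : exp_lap (xv i) = xv i.
Proof.
by rewrite -[xv i]mulr1 exp_lapX exp_lap1 /Xop Dq1 // addr0.
Qed.

Variable bul : V -> V -> V.
Hypothesis bul_linl : forall Q c P P',
  bul (c *: P + P') Q = c *: bul P Q + bul P' Q.
Hypothesis bul_linr : forall P c Q Q',
  bul P (c *: Q + Q') = c *: bul P Q + bul P Q'.
Hypothesis bul_mon : forall a b,
  bul (mon a) (mon b) = mbullet mon (mconvo rho (mtransp rho)) a b.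

(** By induction on [P]: a further factor [x_i] applies [L_i] to both sides, on the right through
    [bul_Xop]. *)
Lemma exp_lapM P Q : exp_lap (P * Q) = bul (exp_lap P) (exp_lap Q).
Proof.
have s1 b := mconvo1 b rhoB.
have sU i a b := mconvoU i a b rhoB.
elim/(mon_indX monV): P => [|c P P' hP hP'|i P hP].
- by rewrite mul1r exp_lap1 (bul1 monV s1 bul_linr bul_mon).
- by rewrite mulrDl -scalerAl !exp_lap_lin hP hP' bul_linl.
by rewrite -mulrA !exp_lapX hP (bul_Xop monV lext_mon sU bul_linl bul_linr bul_mon).
Qed.

Lemma mon_prod m : mon m = \prod_(i <- finsupp m) xv i ^+ m i.
Proof.
elim/cmonom_ind: m => [|i m IH]; first by rewrite mdom1 big_seq_fset0 (mon1 monV).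
by rewrite (monM monV) prod_finsuppM -IH mdomU big_seq_fset1 cmUU expr1.
Qed.

(** The ordinary and the bullet products are bracketed along the same list of variables, so
    [exp_lapM] applies factor by factor, and each variable is fixed. *)
Lemma exp_lap_mon_bul m :
  exp_lap (mon m) = \big[bul/1]_(i <- finsupp m) iter (m i) (bul (xv i)) 1.
Proof.
rewrite mon_prod; elim: (enum_fset (finsupp m)) => [|i v IH].
  by rewrite !big_nil exp_lap1.
rewrite !big_cons exp_lapM IH; congr (bul _ _).
elim: (m i) => [|n IHn]; first exact: exp_lap1.
by rewrite exprS exp_lapM exp_lap_xv IHn.
Qed.

Definition mEQ m : V :=
  cop3 (GRing.in_alg A) (fun a b c => rho a b *: mon c) m.

(** In the third slot [x_i] multiplies the result. In the first it becomes a derivation of the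
    second slot with coefficients [q_ij]; in the second, by transposition, a derivation of the first
    with coefficients [q_ji]. *)
Lemma mEQU i m : mEQ (ucm i * m)%M = Xop i (mEQ m).
Proof.
pose h a b c := rho a b *: mon c.
pose th q := @scaleby A V q.
(* [D_q] acts on the third slot only, which amounts to deriving [m]. *)
have Dq_mEQ q : Dq q (mEQ m) = pder (th q) mEQ m.
  rewrite -(cop3_pder3 (GRing.in_alg A) (th q) h).
  rewrite (raddf_cop3 _ (GRing.in_alg A)); apply: eq_cop3 => a b c.
  rewrite /= linearZ /= Dq_mon // -[LHS]/( *:%R (rho a b) _).
  by rewrite (raddf_pder (th' := th q)) // => j x; rewrite /= !scalerA mulrC.
rewrite /mEQ cop3U /Xop addrC; congr (_ + _).
  rewrite -[RHS]/(GRing.mull_fun (xv i) idfun _).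
  rewrite (raddf_cop3 _ (GRing.in_alg A)); apply: eq_cop3 => a b c.
  by rewrite /= (monM monV) scalerAr.
rewrite -/(mEQ m) Dq_mEQ.
have htr := mbichar_transp rhoB.
rewrite -(pderDth (th := th (qrow rho i))
                  (th' := th (qrow (mtransp rho) i))); last first.
  by move=> j x; rewrite /= scalerDl.
congr (_ + _).
  rewrite -(cop3_pder2 (GRing.in_alg A) _ h); apply: eq_cop3 => a b c.
  rewrite mbicharU // -[LHS]/(scalev (mon c) _).
  rewrite [LHS](raddf_pder (th' := th (qrow rho i))) //.
  by move=> j x; rewrite /= /scalev scalerA.
rewrite -(cop3_pder1 (GRing.in_alg A) _ h); apply: eq_cop3 => a b c.
rewrite -[rho _ _]/(mtransp rho _ _) mbicharU // -[LHS]/(scalev (mon c) _).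
rewrite [LHS](raddf_pder (th' := th (qrow (mtransp rho) i))) //.
by move=> j x; rewrite /= /scalev scalerA.
Qed.

Lemma exp_lap_mEQ m : exp_lap (mon m) = mEQ m.
Proof.
elim/cmonom_ind: m => [|i m IH].
  rewrite (mon1 monV) exp_lap1 /mEQ cop3_1 (mon1 monV).
  by case: rhoB => r1 _ _; rewrite (proj1 (r1 _)) eqxx scale1r.
by rewrite mEQU -IH (monM monV) exp_lapX.
Qed.

End Exponential.

(** * The second-order operator *)

Section Laplacian.
Variables (A : comNzRingType) (V : comAlgType A) (mon : cmonom nat -> V).
Hypothesis monV : polynomial_basis mon.
Variable lext : (cmonom nat -> V) -> {linear V -> V}.
Hypothesis lext_mon : forall f m, lext f (mon m) = f m.
Local Notation xv i := (mon (ucm i)).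
Local Notation Dq := (Dq mon lext).
Local Notation d n := (Dq (fun j => (j == n)%:R)).
Implicit Types (P Q : V) (v : seq nat) (q : nat -> nat -> A).

(** Partial derivatives are [Dq] with Kronecker coefficients, so that the rules for [Dq] apply to
    them. *)
Lemma d_mon n m : d n (mon m) = mon (divcm m (ucm n)) *+ m n.
Proof.
rewrite Dq_mon // pder.unlock; have [nm|nm] := boolP (n \in finsupp m).
  rewrite (big_fsetD1 n) //= eqxx scale1r big1_fset ?addr0 // => j.
  by rewrite !inE => /andP[/negPf->] _ _; rewrite scale0r mul0rn.
rewrite [in RHS](_ : m n = 0%N); last by apply/eqP; rewrite cmE_eq0.
rewrite big1_fset // => j jm _; rewrite /= (_ : (j == n) = false).
  by rewrite scale0r mul0rn.
by apply: contraNF nm => /eqP<-.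
Qed.

(** Phrased through vanishing derivatives, since the abstract [V] carries no notion of support. *)
Definition vars_in v P := forall n, n \notin v -> d n P = 0.

Lemma vars_in_lin v c P Q :
  vars_in v P -> vars_in v Q -> vars_in v (c *: P + Q).
Proof. by move=> hP hQ n nv; rewrite linearP hP // hQ // scaler0 addr0. Qed.

Lemma vars_in_sub v v' P : {subset v <= v'} -> vars_in v P -> vars_in v' P.
Proof. by move=> sv hP n; move/(contra (sv n)); apply: hP. Qed.

Lemma sum_uniq_support (W : zmodType) (f : nat -> W) v v' : uniq v -> uniq v' ->
  (forall n, n \notin v -> f n = 0) -> (forall n, n \notin v' -> f n = 0) ->
  \sum_(n <- v) f n = \sum_(n <- v') f n.
Proof.
move=> uv uv' f0 f0'.
have restrict u : \sum_(n <- u) f n = \sum_(n <- u | f n != 0) f n.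
  by rewrite [LHS](bigID (fun n => f n == 0)) /= big1 ?add0r // => n /eqP.
rewrite !restrict -[LHS]big_filter -[RHS]big_filter; apply: perm_big.
apply: uniq_perm; rewrite ?filter_uniq // => n; rewrite !mem_filter.
case: (eqVneq (f n) 0) => //= fn0.
have -> : n \in v by apply: contraNT fn0 => /f0->.
by apply/esym; apply: contraNT fn0 => /f0'->.
Qed.

(** The list is existential so that the induction can merge the lists of two summands, and it does
    not depend on [q]; [DqE] passes to any suitable list. *)
Lemma Dq_finite P :
  exists v, [/\ uniq v, vars_in v P &
    forall q : nat -> A, Dq q P = \sum_(n <- v) q n *: d n P].
Proof.
elim/(mon_ind monV): P => [c P Q [v [uv vP hP]] [v' [uv' vQ hQ]]|m].
  exists (undup (v ++ v')); have uw := undup_uniq (v ++ v').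
  have sv : {subset v <= undup (v ++ v')}.
    by move=> n; rewrite mem_undup mem_cat => ->.
  have sv' : {subset v' <= undup (v ++ v')}.
    by move=> n; rewrite mem_undup mem_cat orbC => ->.
  split=> // [|q].
    by apply: vars_in_lin; [move: vP|move: vQ]; apply: vars_in_sub.
  rewrite linearP hP hQ (sum_uniq_support uv uw); first last.
  - by move=> n /(vars_in_sub sv vP)->; rewrite scaler0.
  - by move=> n /vP->; rewrite scaler0.
  rewrite (sum_uniq_support uv' uw); first last.
  - by move=> n /(vars_in_sub sv' vQ)->; rewrite scaler0.
  - by move=> n /vQ->; rewrite scaler0.
  rewrite scaler_sumr -big_split; apply: eq_bigr => n _.
  by rewrite linearP scalerDr !scalerA [c * _]mulrC.
exists (finsupp m); split=> [||q]; first exact: fset_uniq.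
  by move=> n; rewrite -cmE_eq0 d_mon => /eqP->.
rewrite Dq_mon // pder.unlock; apply: eq_bigr => n _.
by rewrite d_mon scalerMnr.
Qed.

Lemma DqE (q : nat -> A) v P : uniq v -> vars_in v P ->
  Dq q P = \sum_(n <- v) q n *: d n P.
Proof.
move=> uv hv; have [v' [uv' hv' ->]] := Dq_finite P.
by apply: sum_uniq_support => // n; [move/hv'->|move/hv->]; rewrite scaler0.
Qed.

Definition lapv q v P : V := \sum_(m <- v) \sum_(n <- v) q m n *: d m (d n P).

Lemma lapv_indep q v v' P : uniq v -> uniq v' ->
  vars_in v P -> vars_in v' P -> lapv q v P = lapv q v' P.
Proof.
move=> uv uv' hv hv'; rewrite /lapv.
have ddC m n : d m (d n P) = d n (d m P) by apply: Dq_comm.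
(* An intermediate sum with only the inner list replaced. For the outer list, [ddC] lets the outer
   derivative act first on [P]. *)
rewrite [LHS](_ : _ = \sum_(m <- v) \sum_(n <- v') q m n *: d m (d n P)).
  apply: sum_uniq_support => // m mv; rewrite big1 // => n _.
    by rewrite ddC hv // linear0 scaler0.
  by rewrite ddC hv' // linear0 scaler0.
apply: eq_bigr => m _; apply: sum_uniq_support => // n nv.
  by rewrite hv // linear0 scaler0.
by rewrite hv' // linear0 scaler0.
Qed.

Lemma lapv_lin q v c P Q : lapv q v (c *: P + Q) = c *: lapv q v P + lapv q v Q.
Proof.
rewrite scaler_sumr -big_split; apply: eq_bigr => m _.
rewrite scaler_sumr -big_split; apply: eq_bigr => n _.
by rewrite !linearP.
Qed.

Variable vr : V -> seq nat.
Hypothesis vr_uniq : forall P, uniq (vr P).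
Hypothesis vr_in : forall P, vars_in (vr P) P.
Variable q : nat -> nat -> A.

Definition lapl P : V := lapv q (vr P) P.

Lemma laplE v P : uniq v -> vars_in v P -> lapl P = lapv q v P.
Proof. by move=> uv hv; apply: lapv_indep. Qed.

(** The list [vr P] varies with the polynomial; linearity is read off on one list that serves all
    three. *)
Lemma lapl_lin c P Q : lapl (c *: P + Q) = c *: lapl P + lapl Q.
Proof.
pose v := undup (vr P ++ vr Q).
have vP : vars_in v P.
  by apply: vars_in_sub (vr_in (P := P)) => n; rewrite mem_undup mem_cat => ->.
have vQ : vars_in v Q.
  by apply: vars_in_sub (vr_in (P := Q)) => n; rewrite mem_undup mem_cat orbC => ->.
have uv : uniq v by apply: undup_uniq.
by rewrite !(laplE uv) ?lapv_lin //; apply: vars_in_lin.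
Qed.

Lemma lapl1 : lapl 1 = 0.
Proof. by rewrite (@laplE [::]) /lapv ?big_nil // => n _; apply: Dq1. Qed.

(** From [d_m d_n (x_i P) = x_i d_m d_n P + [i=n] d_m P + [i=m] d_n P]; summation against [q_mn]
    collapses the Kronecker terms. *)
Lemma laplX i P :
  lapl (xv i * P) = xv i * lapl P + Dq (fun j => q i j + q j i) P.
Proof.
(* One list for [P] and [x_i P]; it has to contain [i] for the Kronecker sums. *)
pose v := undup (i :: vr P).
have iv : i \in v by rewrite mem_undup inE eqxx.
have uv : uniq v by apply: undup_uniq.
have vP : vars_in v P.
  by apply: vars_in_sub (vr_in (P := P)) => n; rewrite mem_undup inE orbC => ->.
have vX : vars_in v (xv i * P).
  move=> n nv; rewrite Dq_X // vP // mulr0 addr0.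
  by rewrite (_ : (i == n) = false) ?scale0r //; apply: contraNF nv => /eqP<-.
have delta_sum (f : nat -> V) : \sum_(n <- v) (i == n)%:R *: f n = f i.
  rewrite (bigD1_seq i) //= eqxx scale1r big1 ?addr0 // => n.
  by rewrite eq_sym => /negPf->; rewrite scale0r.
rewrite !(laplE uv) // (DqE _ uv vP).
transitivity (\sum_(m <- v) (xv i * (\sum_(n <- v) q m n *: d m (d n P)) +
   (q m i *: d m P + (i == m)%:R *: \sum_(n <- v) q m n *: d n P))).
  apply: eq_bigr => m _.
  transitivity (\sum_(n <- v) (xv i * (q m n *: d m (d n P)) +
     ((i == n)%:R *: (q m n *: d m P) + (i == m)%:R *: (q m n *: d n P)))).
    apply: eq_bigr => n _; rewrite Dq_X // linearD linearZ Dq_X //.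
    rewrite !scalerDr !scalerA addrA addrC -scalerAr; congr (_ + (_ + _)).
      by rewrite [q m n * _]mulrC.
    by rewrite [q m n * _]mulrC.
  by rewrite !big_split /= -mulr_sumr -scaler_sumr delta_sum.
rewrite !big_split /= -mulr_sumr delta_sum; congr (_ + _).
rewrite addrC -big_split; apply: eq_bigr => n _.
by rewrite scalerDl.
Qed.

End Laplacian.

(** * Transfer to polynomials *)

Section Main.
Variables (R : realType) (A : comAlgType R[i]).
Local Notation C := R[i].
Local Notation V0 := (mpol C nat).
Local Notation VA := (mpol A nat).
Implicit Types (r s : V0 -> V0 -> A) (a b m : cmonom nat) (P Q : VA).

Lemma mmon_basis : polynomial_basis (mmon : cmonom nat -> VA).
Proof. by split; [exact: mmon1 | exact: mmonM | exact: mpol_mmon_ind]. Qed.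

Definition mlext (f : cmonom nat -> VA) : {linear VA -> VA} :=
  sext idfun f.

Lemma mlext_mmon f m : mlext f (mmon m) = f m.
Proof. exact: sext_mmon. Qed.

Lemma toA_sext (P : V0) : toA P = \sum_(m <- msupp P) (P@_m)%:A *: (mmon m : VA).
Proof.
rewrite /toA; apply: eq_bigr => m _.
by apply/malgP => n; rewrite mcoeffZ [LHS]mcoeffU mcoeffU1 mulr_natr.
Qed.

Lemma toA_mmon m : toA (mmon m : V0) = mmon m :> VA.
Proof.
rewrite toA_sext /mmon msuppU1 big_seq_fset1 [X in X *: _](_ : _ = 1) ?scale1r //.
by rewrite mcoeffUU scale1r.
Qed.

Definition bimon r a b : A := r (mmon a) (mmon b).

Lemma mbichar_bimon r : bicharacter r -> mbichar (bimon r).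
Proof.
case=> _ _ r1 rMl rMr; split=> [a|a b c|a b c]; rewrite /bimon.
- have counitA : (counit (mmon a : V0))%:A = (a == 1%M)%:R :> A.
    by rewrite counit_mmon; case: (a == 1%M); rewrite ?scale1r ?scale0r.
  by have [ra ra'] := r1 (mmon a); rewrite -counitA; split; [exact: ra|exact: ra'].
- by rewrite (mmonM _ a b) [LHS]rMl sw2_id.
- by rewrite (mmonM _ b c) [LHS](rMr (mmon a) (mmon b)) sw2_id.
Qed.

Lemma convo_mmon r a b : convo r (transp r) (mmon a) (mmon b) =
  mconvo (bimon r) (mtransp (bimon r)) a b.
Proof. by rewrite /convo sw2_id; apply: eq_cop2 => a1 a2; rewrite sw2_id. Qed.

Lemma bullet0_mmon s sigma a b :
  (forall m n, s (mmon m) (mmon n) = sigma m n) ->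
  bullet0 s (mmon a) (mmon b) = mbullet (mmon : cmonom nat -> VA) sigma a b.
Proof.
move=> s_sigma; rewrite /bullet0 sw2_alg mbullet.unlock; apply: eq_cop2 => a1 a2.
by rewrite sw2_alg; apply: eq_cop2 => b1 b2; rewrite s_sigma -mmonM toA_mmon.
Qed.

Lemma bullet_sext s P Q : bullet s P Q =
  sext idfun (fun m => sext idfun (fun n => bullet0 s (mmon m) (mmon n)) Q) P.
Proof.
rewrite sextE; apply: eq_bigr => m _; rewrite sextE scaler_sumr.
by apply: eq_bigr => n _; rewrite scalerA.
Qed.

Lemma bullet_linl s Q c P P' :
  bullet s (c *: P + P') Q = c *: bullet s P Q + bullet s P' Q.
Proof. by rewrite !bullet_sext raddfD /= sextZ. Qed.

Lemma bullet_linr s P c Q Q' :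
  bullet s P (c *: Q + Q') = c *: bullet s P Q + bullet s P Q'.
Proof.
rewrite !bullet_sext !sextE scaler_sumr -big_split; apply: eq_bigr => m _.
by rewrite raddfD /= sextZ scalerDr !scalerA mulrC.
Qed.

Lemma mderiv_Dq n P : mderiv n P = Dq mmon mlext (fun j => (j == n)%:R) P.
Proof.
rewrite -[RHS]/(sext _ _ _) sextE; apply: eq_bigr => m _.
rewrite -(Dq_mon mlext_mmon) (d_mon mlext_mmon).
apply/malgP => x; rewrite mcoeffZ [LHS]mcoeffU mcoeffMn mcoeffU1.
by rewrite mulrnAr mulr_natr -mulrnA mulnC mulrnA.
Qed.

Lemma vars_uniq P : uniq (vars P).
Proof. exact: undup_uniq. Qed.

Lemma vars_in_vars P : vars_in mmon mlext (vars P) P.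
Proof.
move=> n nv; rewrite -mderiv_Dq /mderiv big1_seq // => m /= mP.
suff /eqP-> : m n == 0%N by rewrite mulr0n monalgU0.
rewrite cmE_eq0; apply: contra nv => nm.
rewrite mem_undup; apply/flattenP.
by exists (enum_fset (finsupp m)) => //; apply/map_f.
Qed.

Lemma Qp_lapl r P :
  Qp r P = lapl mmon mlext vars (fun i j => r (mX i) (mX j)) P.
Proof.
by apply: eq_bigr => m _; apply: eq_bigr => n _; rewrite !mderiv_Dq.
Qed.

Lemma mconvo_bullet r a b : bullet (convo r (transp r)) (mmon a) (mmon b) =
  mbullet (mmon : cmonom nat -> VA)
    (mconvo (bimon r) (mtransp (bimon r))) a b.
Proof.
rewrite bullet_sext !sext_mmon; apply: bullet0_mmon => m n; exact: convo_mmon.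
Qed.

Lemma Qp_is_linear r : linear (Qp r).
Proof.
move=> c P Q; rewrite !Qp_lapl.
exact: (lapl_lin mmon_basis mlext_mmon vars_uniq vars_in_vars).
Qed.

Definition Qp_lin r : {linear VA -> VA} :=
  HB.pack (Qp r) (GRing.isLinear.Build A VA VA *:%R (Qp r) (@Qp_is_linear r)).

Lemma Qp1 r : Qp r 1 = 0.
Proof.
by rewrite Qp_lapl (lapl1 mmon_basis mlext_mmon vars_uniq vars_in_vars).
Qed.

Lemma QpX r i P : Qp r (mmon (ucm i) * P) =
  mmon (ucm i) * Qp r P + Dq mmon mlext (symq (bimon r) i) P.
Proof.
rewrite !Qp_lapl (laplX mmon_basis mlext_mmon vars_uniq vars_in_vars).
by [].
Qed.

Definition inv_fact k : A := ((k`!)%:R^-1 : C)%:A.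

Lemma inv_fact0 : inv_fact 0 = 1.
Proof. by rewrite /inv_fact fact0 invr1 scale1r. Qed.

Lemma inv_factS k : inv_fact k.+1 *+ k.+1 = inv_fact k.
Proof.
rewrite /inv_fact scalerMnl -[_ *+ k.+1]mulr_natl factS natrM invfM mulVKf //.
by rewrite pnatr_eq0.
Qed.

(** The threshold is the truncation order in [expQ], so [expQ r] is convertible to [exp_lap] with
    [sz P = (msize P).+1] and [w = inv_fact]. *)
Lemma iter_Qp_msize r P k : ((msize P).+1 <= k)%N -> iter k (Qp r) P = 0.
Proof.
move=> le_k; rewrite (mpol_sum P).
apply: (iter_lap_sum mmon_basis mlext_mmon (lap := Qp_lin r)
  (Qp1 r) (QpX r)) => m mP.
by apply: leq_trans (ltnW le_k); apply: msize_mdeg_lt.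
Qed.

Section WithBicharacter.
Variable r : V0 -> V0 -> A.
Hypothesis rB : bicharacter r.
Let s := convo r (transp r).
Let iter_Qp := iter_Qp_msize r.

Lemma expQ1 : expQ r 1 = 1.
Proof.
exact: (exp_lap1 mmon_basis mlext_mmon (lap := Qp_lin r)
  (Qp1 r) (QpX r) inv_fact0 iter_Qp).
Qed.

Lemma expQM P Q : expQ r (P * Q) = bullet s (expQ r P) (expQ r Q).
Proof.
exact: (exp_lapM mmon_basis mlext_mmon (mbichar_bimon rB)
  (lap := Qp_lin r) (Qp1 r) (QpX r)
  inv_fact0 inv_factS iter_Qp (bullet_linl s) (bullet_linr s) (mconvo_bullet r)).
Qed.

Lemma expQ_mmon_bmon m : expQ r (mmon m) = bmon s m.
Proof.
exact: (exp_lap_mon_bul mmon_basis mlext_mmon (mbichar_bimon rB)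
  (lap := Qp_lin r) (Qp1 r) (QpX r)
  inv_fact0 inv_factS iter_Qp (bullet_linl s) (bullet_linr s) (mconvo_bullet r)).
Qed.

Lemma EQ_mmon m :
  EQ r (mmon m) = mEQ (mmon : cmonom nat -> VA) (bimon r) m.
Proof.
by rewrite /EQ sw3_alg; apply: eq_cop3 => a b c; rewrite toA_mmon.
Qed.

Lemma expQ_mmon_EQ m : expQ r (mmon m) = EQ r (mmon m).
Proof.
rewrite EQ_mmon.
exact: (exp_lap_mEQ mmon_basis mlext_mmon (mbichar_bimon rB)
  (lap := Qp_lin r) (Qp1 r) (QpX r)
  inv_fact0 inv_factS iter_Qp).
Qed.

Lemma expQ_toA (P : V0) :
  expQ r (toA P) = \sum_(m <- msupp P) (P@_m)%:A *: expQ r (mmon m).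
Proof.
rewrite toA_sext; exact: (exp_lap_sum _ (lap := Qp_lin r) inv_fact iter_Qp).
Qed.

End WithBicharacter.

End Main.

Theorem theorem3p3 (R : realType) (A : comAlgType R[i])
    (r : mpol R[i] nat -> mpol R[i] nat -> A) :
  bicharacter r ->
  let s := convo r (transp r) in
  (forall P : mpol R[i] nat,
      expQ r (toA P) = EQ r P /\ expQ r (toA P) = Pbullet s P) /\
  ((forall P Q : mpol A nat, expQ r (P * Q) = bullet s (expQ r P) (expQ r Q)) /\
   expQ r 1 = 1).
Proof.
move=> rB s; split=> [P|]; last by split=> [P Q|]; [exact: expQM | exact: expQ1].
(* All sides are expanded linearly in the monomials of [P], which reduces both identities to
   monomials. *)
rewrite expQ_toA; split.
  rewrite [RHS]sw3_alg_sum; apply: eq_bigr => m _.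
  by rewrite (expQ_mmon_EQ rB).
by apply: eq_bigr => m _; rewrite (expQ_mmon_bmon rB).
Qed.
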